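(* Let $f=\mathbb{E}_\xi[f_\xi]$ be $L_{f/h}$-relatively smooth with respect to $h$ (no relative strong convexity assumed), with minimizer $x^\star\in\operatorname{int}\operatorname{dom}h$ satisfying $\nabla f(x^\star)=0$, and suppose the noise assumption below holds with constant $\sigma^2$ and step size $\eta\le1/(2L_{f/h})$. Then the iterates of Bregman stochastic gradient descent with constant step size $\eta$ satisfy, for every $T\ge1$, $$\mathbb{E}\Big[\frac1T\sum_{t=0}^{T}D_f(x^\star,x_t)\Big]\le\frac{D_h(x^\star,x_0)}{\eta T}+\eta\sigma^2.$$
   Context: Let $C\subseteq\mathbb{R}^d$ be a closed convex set and $h:\mathbb{R}^d\to\mathbb{R}\cup\{+\infty\}$ a function satisfying the standing assumption: $h$ is twice continuously differentiable and strictly convex on $\operatorname{int} C$, and for every $y\in\mathbb{R}^d$ the problem $\min_{x\in C} h(x)-x^\top y$ has a unique solution, which lies in $\operatorname{int} C$. $h^*$ is the convex conjugate of $h$. For differentiable $\varphi$, $D_\varphi(x,y)=\varphi(x)-\varphi(y)-\nabla\varphi(y)^\top(x-y)$. A differentiable $f$ is $L$-relatively smooth w.r.t. $h$ if $D_f(x,y)\le L D_h(x,y)$ for all $x,y\in\operatorname{int}\operatorname{dom}h$. Bregman stochastic gradient descent (BSGD): given $x_0\in\operatorname{int}C$, $x_{t+1}=\arg\min_{x\in C}\{\eta g_t^\top x+D_h(x,x_t)\}$, equivalently $\nabla h(x_{t+1})=\nabla h(x_t)-\eta g_t$, where $g_t=\nabla f_{\xi_t}(x_t)$ and $\xi_t$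 are drawn independently from the distribution of $\xi$. Noise assumption: every $f_\xi$ is convex and $L_{f/h}$-relatively smooth w.r.t. $h$, $\mathbb{E}_\xi[f_\xi]=f$, and there is $\sigma^2\ge0$ such that for all $t$, $\sigma^2\ge\frac{1}{2\eta^2}\mathbb{E}_{\xi_t}\big[D_{h^*}(\nabla h(x_t)-2\eta\nabla f_{\xi_t}(x^\star),\nabla h(x_t))\big]$. *)

(* Defs.v *)
From HB Require Import structures.
From mathcomp Require Import all_boot all_order all_algebra.
From mathcomp Require Import all_classical all_reals all_analysis.

Set Implicit Arguments.
Unset Strict Implicit.
Unset Printing Implicit Defensive.

Import Order.TTheory GRing.Theory Num.Theory.
Import numFieldNormedType.Exports.

Local Open Scope classical_set_scope.
Local Open Scope ring_scope.

Section BregmanDefs.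
Variables (R : realType) (d : nat).

Definition dotp (x y : 'rV[R]_d) : R := \sum_(i < d) x 0 i * y 0 i.

Definition grad (phi : 'rV[R]_d -> R) (x : 'rV[R]_d) : 'rV[R]_d :=
  \row_(i < d) 'D_(delta_mx 0 i) phi x.

Definition bregman (phi : 'rV[R]_d -> R) (x y : 'rV[R]_d) : R :=
  phi x - phi y - dotp (grad phi y) (x - y).

Definition convex_on (A : set 'rV[R]_d) (phi : 'rV[R]_d -> R) : Prop :=
  forall x y (t : R), A x -> A y -> 0 <= t <= 1 ->
    phi (t *: x + (1 - t) *: y) <= t * phi x + (1 - t) * phi y.

Definition strictly_convex_on (A : set 'rV[R]_d) (h : 'rV[R]_d -> \bar R) : Prop :=
  forall x y (t : R), A x -> A y -> x != y -> 0 < t < 1 ->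
    (h (t *: x + (1 - t) *: y)%R < t%:E * h x + (1 - t)%:E * h y)%E.

Definition C2_on (A : set 'rV[R]_d) (phi : 'rV[R]_d -> R) : Prop :=
  [/\ forall x, A x -> differentiable phi x,
      forall v x, A x -> differentiable ('D_v phi) x &
      forall u v x, A x -> {for x, continuous ('D_u ('D_v phi))}].

Definition conjugate (h : 'rV[R]_d -> \bar R) (y : 'rV[R]_d) : \bar R :=
  ereal_sup [set ((dotp x y)%:E - h x)%E | x in [set: 'rV[R]_d]].

Definition rel_smooth (A : set 'rV[R]_d) (L : R) (phi hR : 'rV[R]_d -> R) : Prop :=
  forall x y, A x -> A y -> bregman phi x y <= L * bregman hR x y.

End BregmanDefs.

(* Expectation over i.i.d. samples xi_0, ..., xi_(n-1) of law P of a function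
   of the history [:: xi_0; ...; xi_(n-1)], as the iterated integral
   \int[P]_(xi_0) ... \int[P]_(xi_(n-1)) G [:: xi_0; ...; xi_(n-1)]. *)
Fixpoint iexp {dX : measure_display} {X : measurableType dX} {R : realType}
  (P : probability X R) (n : nat) (G : seq X -> \bar R) : \bar R :=
  match n with
  | 0 => G [::]
  | n'.+1 => (\int[P]_xi iexp P n' (fun s => G (xi :: s)))%E
  end.

(* Main.v *)
(** The standing assumption makes [h] a Legendre function: its gradient is a
    bijection from the interior of [C] onto the whole space, and [grad hstar] is
    the inverse bijection.  Hence [D_h(x_t, x_{t+1})] equals
    [D_hstar(grad h(x_t) - eta g_t, grad h(x_t))].  Splitting
    [g_t = (g_t - gs) + gs] with [gs := grad (F xi) xstar] and using convexity of
    [hstar], the first half is controlled by Bregman cocoercivity of [F xi] and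
    the second is the noise.  Taking means, where [gs] averages to
    [grad f xstar = 0], gives
    [eta D_f(xstar, x_t)
       <= D_h(xstar, x_t) - E D_h(xstar, x_{t+1}) + eta^2 sigma^2].
    Telescoping over [t < T] leaves [- E D_h(xstar, x_T)], which absorbs the term
    [t = T] because [eta D_f(xstar, x_T) <= D_h(xstar, x_T)] by relative
    smoothness. *)
Require Import Defs.
From HB Require Import structures.
From mathcomp Require Import all_boot all_order all_algebra.
From mathcomp Require Import all_classical all_reals all_analysis.
From mathcomp Require Import measurable_realfun ring lra.

Set Implicit Arguments.
Unset Strict Implicit.
Unset Printing Implicit Defensive.

Import Order.TTheory GRing.Theory Num.Theory.
Import numFieldNormedType.Exports.

Local Open Scope classical_set_scope.
Local Open Scope ring_scope.

Section Topology.
Context {R : realType}.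

Lemma near_right_ray {V : normedModType R} (A : set V) (z v : V) :
  nbhs z A -> \forall t \near (0 : R)^'+, A (z + t *: v).
Proof.
suff zv : (z + t *: v @[t --> (0 : R)^'+] --> z)%classic by exact: zv.
rewrite -[X in _ --> X]addr0 -(scale0r v); apply: cvg_at_right_filter.
by apply: cvgD; [exact: cvg_cst|apply: cvgZr_tmp; exact: cvg_id].
Qed.

Lemma compact_continuous_gt0 {T : topologicalType} (S : set T) (g : T -> R) :
  compact S -> {within S, continuous g} -> (forall w, S w -> 0 < g w) ->
  exists2 m, 0 < m & forall w, S w -> m <= g w.
Proof.
move=> cptS ctg g_gt0; have [S0|/set0P/negP/negPn/eqP S0] := pselect (S !=set0).
  have [c /set_mem Sc cmin] := compact_EVT_min S0 cptS ctg.
  by exists (g c) => [|w Sw]; [exact: g_gt0|rewrite cmin ?inE].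
by exists 1 => // w; rewrite S0.
Qed.

Lemma compact_sphere {d : nat} (a : 'rV[R]_d) (r : R) :
  compact [set w | `|w - a| = r].
Proof.
apply: bounded_closed_compact.
  exists (`|a| + r); split => [|M aM w /= wa]; first exact: num_real.
  by rewrite -(subrK a w) (le_trans (ler_normD _ _))// wa addrC ltW.
have -> : [set w | `|w - a| = r] = (fun w => `|w - a|) @^-1` [set r] by [].
apply: preimage_closed => [w _|]; last exact: closed_eq.
have wa : (v - a @[v --> w] --> w - a)%classic.
  exact: (cvgB cvg_id (cvg_cst a)).
exact: (cvg_norm wa).
Qed.

End Topology.

Section InnerProduct.
Context {R : realType} {d : nat}.
Implicit Types u v w : 'rV[R]_d.

Lemma dotpC u v : dotp u v = dotp v u.
Proof. by apply: eq_bigr => i _; rewrite mulrC. Qed.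

Lemma dotpDl u v w : dotp (u + v) w = dotp u w + dotp v w.
Proof. by rewrite -big_split; apply: eq_bigr => i _; rewrite !mxE mulrDl. Qed.

Lemma dotpZl (c : R) u v : dotp (c *: u) v = c * dotp u v.
Proof.
by rewrite /dotp mulr_sumr; apply: eq_bigr => i _; rewrite !mxE mulrA.
Qed.

Lemma dotpNl u v : dotp (- u) v = - dotp u v.
Proof. by rewrite -scaleN1r dotpZl mulN1r. Qed.

Lemma dotpDr u v w : dotp u (v + w) = dotp u v + dotp u w.
Proof. by rewrite dotpC dotpDl !(dotpC u). Qed.

Lemma dotpZr (c : R) u v : dotp u (c *: v) = c * dotp u v.
Proof. by rewrite dotpC dotpZl dotpC. Qed.

Lemma dotpNr u v : dotp u (- v) = - dotp u v.
Proof. by rewrite dotpC dotpNl dotpC. Qed.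

Definition dotpE := (dotpDl, dotpDr, dotpNl, dotpNr, dotpZl, dotpZr).

Lemma dotp0l v : dotp 0 v = 0.
Proof. by rewrite -(scale0r 0) dotpZl mul0r. Qed.

Lemma dotp_delta u (i : 'I_d) : dotp u (delta_mx 0 i) = u 0 i.
Proof.
rewrite /dotp (bigD1 i)//= big1 ?addr0; first by rewrite mxE !eqxx mulr1.
by move=> j /negPf ji; rewrite mxE ji andbF mulr0.
Qed.

Lemma dotp_linear u : linear (dotp u : 'rV[R]_d -> R^o).
Proof. by move=> c v w; rewrite dotpDr dotpZr. Qed.

HB.instance Definition _ u :=
  GRing.isLinear.Build R 'rV[R]_d R^o _ (dotp u) (dotp_linear u).

Lemma dotp_continuous u : continuous (dotp u : 'rV[R]_d -> R).
Proof.
rewrite /dotp; apply: continuous_big => [|i _ w]; first exact: add_continuous.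
have coordi : (v 0 i @[v --> w] --> w 0 i)%classic by exact: coord_continuous.
exact: (cvgM (cvg_cst (u 0 i)) coordi).
Qed.

Lemma ler_norm_coord u (i : 'I_d) : `|u 0 i| <= `|u|.
Proof.
rewrite [leRHS]/Num.Def.normr /= mx_normrE.
exact: (le_bigmax _ (fun ij => `|u ij.1 ij.2|) (0, i)).
Qed.

Lemma ler_norm_dotp u v : `|dotp u v| <= d%:R * (`|u| * `|v|).
Proof.
rewrite (le_trans (ler_norm_sum _ _ _))//.
rewrite -[X in X%:R * _](card_ord d) mulr_natl -sumr_const ler_sum// => i _.
by rewrite normrM ler_pM// ler_norm_coord.
Qed.

End InnerProduct.

Section Gradient.
Context {R : realType} {d : nat}.
Implicit Types (a v x y z : 'rV[R]_d) (g phi : 'rV[R]_d -> R) (A : set 'rV[R]_d).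

Lemma derive_grad phi z v : differentiable phi z ->
  'D_v phi z = dotp (grad phi z) v.
Proof.
move=> dphi; rewrite deriveE// [in LHS](row_sum_delta v) linear_sum.
by apply: eq_bigr => i _; rewrite linearZ !mxE deriveE// mulrC.
Qed.

Lemma cvg_difference_quotient phi z v : differentiable phi z ->
  t^-1 * (phi (z + t *: v) - phi z) @[t --> 0^'+] --> dotp (grad phi z) v.
Proof.
move=> dphi; rewrite -derive_grad//.
under eq_fun do rewrite (addrC z).
by apply: cvg_dnbhs_at_right; exact: diff_derivable.
Qed.

Lemma is_diff_dotp g y a :
  (forall e, 0 < e ->
     \forall v \near (0 : 'rV[R]_d),
       `|g (y + v) - g y - dotp a v| <= e * `|v|) ->
  is_diff y g (dotp a : 'rV[R]_d -> R^o).
Proof.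
move=> g_expand; have ctdotp := @dotp_continuous R d a.
have dg : g \o shift y = cst (g y) + dotp a +o_ (0 : 'rV[R]_d) id.
  apply/eqaddoP => e /g_expand; apply: filterS => v.
  by rewrite !fctE/= (addrC v) opprD addrA.
have diffg : 'd g y = dotp a :> (_ -> R^o) by exact: diff_unique.
by apply: DiffDef => //; apply/diff_locallyP; rewrite diffg.
Qed.

Lemma grad_is_diff g y a :
  is_diff y g (dotp a : 'rV[R]_d -> R^o) -> grad g y = a.
Proof.
move=> dg; apply/rowP => i; rewrite mxE deriveE; last exact: ex_diff.
by rewrite diff_val dotp_delta.
Qed.

Lemma grad_argmin A phi z y : nbhs z A -> differentiable phi z ->
  (forall w, A w -> phi z - dotp z y <= phi w - dotp w y) -> grad phi z = y.
Proof.
move=> zA dphi zmin.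
have dir v : dotp y v <= dotp (grad phi z) v.
  apply: cvgr_to_ge (cvg_difference_quotient dphi) _.
  near=> t; have t0 : 0 < t by near: t; exact: nbhs_right_gt.
  have /zmin : A (z + t *: v) by near: t; exact: near_right_ray.
  by rewrite ler_pdivlMl// !dotpE (dotpC v); lra.
apply/rowP => i; apply/eqP; rewrite eq_le -!dotp_delta dir andbT.
by have := dir (- delta_mx 0 i); rewrite !dotpNr lerN2.
Unshelve. all: by end_near. Qed.

End Gradient.

Lemma convex_combE {R : pzRingType} {V : lmodType R} (t : R) (x y : V) :
  t *: x + (1 - t) *: y = y + t *: (x - y).
Proof. by rewrite scalerBl scale1r scalerBr addrCA. Qed.

Section BregmanDivergence.
Context {R : realType} {d : nat}.
Implicit Types (a v w x y z : 'rV[R]_d) (phi : 'rV[R]_d -> R) (A : set 'rV[R]_d).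

Lemma bregmanxx phi x : bregman phi x x = 0.
Proof. by rewrite /bregman !subrr dotpC dotp0l subr0. Qed.

Lemma bregman_shift phi x v :
  bregman phi (x + v) x = phi (x + v) - phi x - dotp (grad phi x) v.
Proof. by rewrite /bregman [X in dotp _ X]addrAC subrr add0r. Qed.

Lemma bregman_three_points phi x y z : bregman phi x z =
  bregman phi x y + bregman phi y z + dotp (grad phi y - grad phi z) (x - y).
Proof. by rewrite /bregman !dotpE; ring. Qed.

Lemma bregmanD_sym phi x y :
  bregman phi x y + bregman phi y x = dotp (grad phi x - grad phi y) (x - y).
Proof. by rewrite /bregman !dotpE; ring. Qed.

Lemma bregman_continuous phi a x : differentiable phi x ->
  {for x, continuous (bregman phi ^~ a)}.
Proof.
move=> dphi; have phix : (phi w @[w --> x] --> phi x)%classic.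
  exact: differentiable_continuous.
have xa : (w - a @[w --> x] --> x - a)%classic.
  exact: (cvgB cvg_id (cvg_cst a)).
have dotxa : (dotp (grad phi a) (w - a) @[w --> x] -->
    dotp (grad phi a) (x - a))%classic.
  exact: (continuous_cvg _ (@dotp_continuous _ _ (grad phi a) (x - a)) xa).
exact: (cvgB (cvgB phix (cvg_cst (phi a))) dotxa).
Qed.

Lemma convex_on_bregman A phi a :
  convex_on A phi -> convex_on A (bregman phi ^~ a).
Proof.
move=> cphi x y t Ax Ay t01; have := cphi x y t Ax Ay t01.
by rewrite /bregman !dotpE; lra.
Qed.

Lemma bregman_ge0 A phi x y : convex_on A phi -> A x -> A y ->
  differentiable phi y -> 0 <= bregman phi x y.
Proof.
move=> cphi Ax Ay dphi; rewrite subr_ge0.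
apply: cvgr_to_le (cvg_difference_quotient dphi) _.
near=> t; have t0 : 0 < t by near: t; exact: nbhs_right_gt.
have t1 : t <= 1 by near: t; exact: nbhs_right_le.
have := cphi x y t Ax Ay; rewrite (ltW t0) t1 => /(_ isT).
by rewrite convex_combE ler_pdivrMl//; lra.
Unshelve. all: by end_near. Qed.

Lemma dotp_grad_le_difference_quotient A phi z v t : convex_on A phi ->
  A z -> A (z + t *: v) -> differentiable phi z -> 0 < t ->
  dotp (grad phi z) v <= t^-1 * (phi (z + t *: v) - phi z).
Proof.
move=> cphi Az At dphi t0; rewrite ler_pdivlMl// -dotpZr.
by have := bregman_ge0 cphi At Az dphi; rewrite bregman_shift subr_ge0.
Qed.

Lemma strictly_convex_on_convex A phi :
  strictly_convex_on A (EFin \o phi) -> convex_on A phi.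
Proof.
move=> sphi x y t Ax Ay /andP[t0 t1].
have [->|xy] := eqVneq x y.
  by rewrite -scalerDl -mulrDl subrKC scale1r mul1r.
have [->|t_neq0] := eqVneq t 0.
  by rewrite scale0r add0r subr0 scale1r mul0r mul1r add0r.
have [->|t_neq1] := eqVneq t 1.
  by rewrite subrr scale0r addr0 scale1r mul0r mul1r addr0.
have t01 : 0 < t < 1 by rewrite lt_def t_neq0 t0 lt_neqAle t_neq1 t1.
by have := sphi x y t Ax Ay xy t01; rewrite /= -!EFinM -EFinD lte_fin => /ltW.
Qed.

(* [A] need not be convex, so strictness is used at a short step from [y]
   towards [x]. *)
Lemma bregman_gt0 A phi x y : open A -> strictly_convex_on A (EFin \o phi) ->
  A x -> A y -> differentiable phi y -> x != y -> 0 < bregman phi x y.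
Proof.
move=> openA sphi Ax Ay dphi xy.
have /filter_ex[t [t0 t1 At]] :
    \forall t \near (0 : R)^'+, [/\ 0 < t, t < 1 & A (y + t *: (x - y))].
  near=> t; split; near: t; [exact: nbhs_right_gt|exact: nbhs_right_lt|].
  by apply: near_right_ray; exact: open_nbhs_nbhs.
have := sphi x y t Ax Ay xy; rewrite t0 t1 => /(_ isT).
rewrite convex_combE.
have := bregman_ge0 (strictly_convex_on_convex sphi) At Ay dphi.
rewrite /= -!EFinM -EFinD lte_fin bregman_shift dotpZr => above below.
by rewrite -(pmulr_rgt0 _ t0) /bregman; lra.
Unshelve. all: by end_near. Qed.

End BregmanDivergence.

(* Rockafellar's cofinite Legendre functions, with essential smoothness replaced
   by what it is used for: [grad phi] maps [A] onto the whole space. *)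
Record legendre {R : realType} {d : nat} (A : set 'rV[R]_d)
    (phi : 'rV[R]_d -> R) : Prop := Legendre {
  legendre_open : open A;
  legendre_strict : strictly_convex_on A (EFin \o phi);
  legendre_diff : forall z, A z -> differentiable phi z;
  legendre_onto : forall y, exists2 z, A z & grad phi z = y }.

Section LegendreFunction.
Context {R : realType} {d : nat} {A : set 'rV[R]_d} {phi : 'rV[R]_d -> R}.
Hypothesis phi_legendre : legendre A phi.
Implicit Types (a x y z : 'rV[R]_d).

Let openA : open A := legendre_open phi_legendre.
Let diff_phi : forall z, A z -> differentiable phi z :=
  legendre_diff phi_legendre.

Lemma legendre_convex : convex_on A phi.
Proof. exact: strictly_convex_on_convex (legendre_strict phi_legendre). Qed.

Lemma legendre_bregman_ge0 x y : A x -> A y -> 0 <= bregman phi x y.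
Proof.
by move=> Ax Ay; exact: (bregman_ge0 legendre_convex Ax Ay (diff_phi Ay)).
Qed.

Lemma legendre_grad_inj x y : A x -> A y -> grad phi x = grad phi y -> x = y.
Proof.
move=> Ax Ay gxy; apply/eqP/negPn/negP => xy.
have := bregmanD_sym phi x y; rewrite gxy subrr dotp0l.
have := bregman_gt0 openA (legendre_strict phi_legendre) Ax Ay (diff_phi Ay) xy.
by have := legendre_bregman_ge0 Ay Ax; lra.
Qed.

(* The constant is [m / r] for the positive minimum [m] of the divergence on a
   sphere of radius [r <= e] around [a]; convexity along rays from [a] does the
   rest. *)
Lemma bregman_linear_growth a (e : R) : A a -> 0 < e ->
  exists2 k, 0 < k &
    forall z, A z -> e <= `|z - a| -> k * `|z - a| <= bregman phi z a.
Proof.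
move=> Aa e0; have /nbhsr0P Ar : nbhs a A by exact: open_nbhs_nbhs.
have /filter_ex[r [r0 re ballA]] : \forall r \near (0 : R)^'+,
    [/\ 0 < r, r <= e & forall w, `|a - w| <= r -> A w].
  near=> r; split; near: r.
  - exact: nbhs_right_gt.
  - exact: nbhs_right_le.
  - exact: Ar.
pose S := [set w | `|w - a| = r].
have SA w : S w -> A w by move=> Sw; apply: ballA; rewrite distrC Sw.
have [m m0 mS] : exists2 m, 0 < m & forall w, S w -> m <= bregman phi w a.
  apply: compact_continuous_gt0; first exact: compact_sphere.
    apply: continuous_in_subspaceT => w /set_mem/SA Aw.
    exact/bregman_continuous/diff_phi.
  move=> w Sw.
  apply: (bregman_gt0 openA (legendre_strict phi_legendre) (SA _ Sw) Aa).
    exact: diff_phi.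
  by apply: contraTneq r0 => wa; rewrite -Sw /= wa subrr normr0 ltxx.
exists (m / r) => [|z Az ez]; first exact: divr_gt0.
have za0 : 0 < `|z - a| by rewrite (lt_le_trans e0).
pose t := r / `|z - a|; have t0 : 0 < t by rewrite divr_gt0.
have t01 : 0 <= t <= 1 by rewrite ltW//= ler_pdivrMr// mul1r (le_trans re).
have /mS : S (t *: z + (1 - t) *: a).
  by rewrite /S /= convex_combE addrC addKr normrZ gtr0_norm// divfK ?gt_eqF.
have /= := convex_on_bregman a legendre_convex Az Aa t01.
rewrite bregmanxx mulr0 addr0 => /[swap] /le_trans /[apply].
by rewrite /t mulrAC ler_pdivlMr// [m / r * _]mulrAC ler_pdivrMr// (mulrC r).
Unshelve. all: by end_near. Qed.

Lemma legendre_grad_inv_continuous a (e : R) : A a -> 0 < e ->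
  exists2 delta : R, 0 < delta & forall z, A z ->
    `|grad phi z - grad phi a| < delta -> `|z - a| < e.
Proof.
move=> Aa e0; have [k k0 growth] := bregman_linear_growth Aa e0.
exists (k / d.+1%:R) => [|z Az]; first by rewrite divr_gt0.
rewrite ltr_pdivlMr ?ltr0Sn// => close; rewrite ltNge; apply/negP => ez.
have za0 : 0 < `|z - a| by rewrite (lt_le_trans e0).
have kza : k * `|z - a| <= d%:R * (`|grad phi z - grad phi a| * `|z - a|).
  apply: le_trans (growth z Az ez) _; apply: le_trans (ler_norm_dotp _ _).
  apply: le_trans (ler_norm _); rewrite -bregmanD_sym lerDl.
  exact: legendre_bregman_ge0.
move: kza; rewrite mulrA ler_pM2r// => kza.
have := normr_ge0 (grad phi z - grad phi a); move: close; rewrite -natr1; lra.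
Qed.

End LegendreFunction.

(* As [grad phi] is onto, this determines [psi] everywhere. *)
Definition legendre_dual {R : realType} {d : nat} (A : set 'rV[R]_d)
    (phi psi : 'rV[R]_d -> R) : Prop :=
  forall a, A a -> psi (grad phi a) = dotp a (grad phi a) - phi a.

Section LegendreDual.
Context {R : realType} {d : nat} {A : set 'rV[R]_d} {phi psi : 'rV[R]_d -> R}.
Hypotheses (phi_legendre : legendre A phi) (psi_dual : legendre_dual A phi psi).
Implicit Types (a b u v w x xn xs y z : 'rV[R]_d) (F : 'rV[R]_d -> R).

Lemma fenchel_young w y : A w -> dotp w y <= phi w + psi y.
Proof.
move=> Aw; have [z Az <-] := legendre_onto phi_legendre y; rewrite psi_dual//.
have := legendre_bregman_ge0 phi_legendre Aw Az.
by rewrite /bregman !dotpE !(dotpC (grad phi z)); lra.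
Qed.

Lemma legendre_dual_subgradient a u : A a ->
  dotp a (u - grad phi a) <= psi u - psi (grad phi a).
Proof.
by move=> Aa; have := fenchel_young u Aa; rewrite psi_dual// !dotpE; lra.
Qed.

Lemma is_diff_legendre_dual a : A a ->
  is_diff (grad phi a) psi (dotp a : 'rV[R]_d -> R^o).
Proof.
move=> Aa; apply: is_diff_dotp => e e0.
have e_d0 : 0 < e / d.+1%:R by rewrite divr_gt0.
have [delta delta0 close] := legendre_grad_inv_continuous phi_legendre Aa e_d0.
near=> v; have v_delta : `|v| < delta by near: v; exact: (@nbhs0_lt _ 'rV[R]_d).
have [z Az zE] := legendre_onto phi_legendre (grad phi a + v).
have vE : grad phi z - grad phi a = v by rewrite zE addrC addKr.
have lower := legendre_dual_subgradient (grad phi z) Aa.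
have upper := legendre_dual_subgradient (grad phi a) Az.
have za : `|z - a| <= e / d.+1%:R by rewrite ltW// close// vE.
rewrite -zE ger0_norm; last by rewrite -vE subr_ge0.
apply: (@le_trans _ _ (dotp (z - a) v)).
  by move: upper; rewrite -opprB vE !dotpE; lra.
apply: le_trans (ler_norm _) (le_trans (ler_norm_dotp _ _) _).
rewrite mulrA ler_wpM2r//; apply: (@le_trans _ _ (d.+1%:R * (e / d.+1%:R))).
  by rewrite ler_pM// ler_nat.
by rewrite mulrC divfK.
Unshelve. all: by end_near. Qed.

Lemma grad_legendre_dual a : A a -> grad psi (grad phi a) = a.
Proof. by move=> /is_diff_legendre_dual/grad_is_diff. Qed.

Lemma differentiable_legendre_dual y : differentiable psi y.
Proof.
have [a Aa <-] := legendre_onto phi_legendre y.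
by case: (is_diff_legendre_dual Aa).
Qed.

Lemma convex_on_legendre_dual : convex_on [set: 'rV[R]_d] psi.
Proof.
move=> u v t _ _ /andP[t0 t1].
have [z Az zE] := legendre_onto phi_legendre (t *: u + (1 - t) *: v).
have := legendre_dual_subgradient u Az; have := legendre_dual_subgradient v Az.
rewrite zE !dotpE => psi_v psi_u; nra.
Qed.

Lemma bregman_legendre_dual_ge0 u v : 0 <= bregman psi u v.
Proof.
exact: (bregman_ge0 convex_on_legendre_dual I I (differentiable_legendre_dual v)).
Qed.

Lemma bregman_legendre_dual a b : A a -> A b ->
  bregman psi (grad phi a) (grad phi b) = bregman phi b a.
Proof.
move=> Aa Ab; rewrite /bregman grad_legendre_dual// !psi_dual//.
by rewrite !dotpE !(dotpC (grad phi a)); ring.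
Qed.

Lemma bregman_cocoercive F (L gamma : R) x y : convex_on A F ->
  differentiable F y -> rel_smooth A L F phi ->
  0 <= gamma -> gamma * L <= 1 -> A x -> A y ->
  bregman psi (grad phi x - gamma *: (grad F x - grad F y)) (grad phi x) <=
  gamma * bregman F x y.
Proof.
move=> F_convex F_diff F_smooth gamma0 gammaL Ax Ay.
have [z Az zE] :=
  legendre_onto phi_legendre (grad phi x - gamma *: (grad F x - grad F y)).
rewrite -zE bregman_legendre_dual//.
have Fzy := bregman_ge0 F_convex Az Ay F_diff.
have Fzx := F_smooth z x Az Ax.
have phizx := legendre_bregman_ge0 phi_legendre Az Ax.
rewrite (bregman_three_points F z x y) in Fzy.
have := bregmanD_sym phi z x.
rewrite zE [X in dotp X _]addrAC subrr add0r dotpNl dotpZl => phi_sym.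
nra.
Qed.

(* [grad phi xn] is the midpoint of [grad phi x - 2 eta (grad F x - grad F xs)]
   and [grad phi x - 2 eta grad F xs]. *)
Lemma mirror_step_length_le F (L eta : R) x xs xn : convex_on A F ->
  differentiable F xs -> rel_smooth A L F phi ->
  0 <= eta -> 2 * eta * L <= 1 -> A x -> A xs -> A xn ->
  grad phi xn = grad phi x - eta *: grad F x ->
  bregman phi x xn <= eta * bregman F x xs
    + 2^-1 * bregman psi (grad phi x - (2 * eta) *: grad F xs) (grad phi x).
Proof.
move=> F_convex F_diff F_smooth eta0 etaL Ax Axs Axn xnE.
set p := grad phi x - (2 * eta) *: (grad F x - grad F xs).
set q := grad phi x - (2 * eta) *: grad F xs.
have mid : grad phi xn = 2^-1 *: p + (1 - 2^-1) *: q.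
  by rewrite xnE /p /q; apply/rowP => i; rewrite !mxE; field.
have eta2 : 0 <= 2 * eta by rewrite mulr_ge0.
have := bregman_cocoercive F_convex F_diff F_smooth eta2 etaL Ax Axs.
have half01 : 0 <= (2^-1 : R) <= 1 by lra.
have := convex_on_bregman (grad phi x) convex_on_legendre_dual
  (I : setT p) (I : setT q) half01.
rewrite /= -mid bregman_legendre_dual// -/p -/q; lra.
Qed.

Lemma mirror_step_descent F (L eta : R) x xs xn : convex_on A F ->
  differentiable F xs -> rel_smooth A L F phi ->
  0 <= eta -> 2 * eta * L <= 1 -> A x -> A xs -> A xn ->
  grad phi xn = grad phi x - eta *: grad F x ->
  bregman phi xs xn <= bregman phi xs x - eta * bregman F xs x
    - eta * dotp (grad F xs) (x - xs)
    + 2^-1 * bregman psi (grad phi x - (2 * eta) *: grad F xs) (grad phi x).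
Proof.
move=> F_convex F_diff F_smooth eta0 etaL Ax Axs Axn xnE.
have := mirror_step_length_le F_convex F_diff F_smooth eta0 etaL Ax Axs Axn xnE.
have F_sym := congr1 ( *%R eta) (bregmanD_sym F x xs).
move: F_sym; rewrite (bregman_three_points phi xs x xn) xnE !dotpE => F_sym.
lra.
Qed.

End LegendreDual.

Section ExtendedConvex.
Context {R : realType} {d : nat} {A : set 'rV[R]_d} {h : 'rV[R]_d -> \bar R}.
Implicit Types (w y z : 'rV[R]_d).

Lemma conjugate_argmin y z : h z \is a fin_num ->
  (forall w, (h z - (dotp z y)%:E <= h w - (dotp w y)%:E)%E) ->
  conjugate h y = (dotp z y - fine (h z))%:E.
Proof.
move=> hz zmin; apply/eqP; rewrite eq_le; apply/andP; split; last first.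
  by apply: ereal_sup_ubound; exists z => //; rewrite EFinB fineK.
apply: ge_ereal_sup => _ [w _ <-]; have := zmin w; rewrite -(fineK hz).
by case: (h w) => [r||] //=; rewrite ?leNye// !lee_fin; lra.
Qed.

Hypothesis hNy : forall z, h z != -oo%E.
Hypothesis h_fin : forall z, A z -> h z \is a fin_num.

Lemma strictly_convex_on_fine :
  strictly_convex_on A h -> strictly_convex_on A (EFin \o (fine \o h)).
Proof.
move=> sh x y t Ax Ay xy t01; have := sh x y t Ax Ay xy t01.
rewrite /= -(fineK (h_fin Ax)) -(fineK (h_fin Ay)) -!EFinM -EFinD => h_lt.
by rewrite fineK// fin_real// ltNye hNy (lt_trans h_lt) ?ltry.
Qed.

Hypotheses (openA : open A) (h_strict : strictly_convex_on A h).
Hypothesis h_diff : forall z, A z -> differentiable (fine \o h) z.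
Hypothesis h_argmin : forall y, exists2 z, A z &
  forall w, (h z - (dotp z y)%:E <= h w - (dotp w y)%:E)%E.

Lemma argmin_grad y z : A z ->
  (forall w, (h z - (dotp z y)%:E <= h w - (dotp w y)%:E)%E) ->
  grad (fine \o h) z = y.
Proof.
move=> Az zmin.
apply: (@grad_argmin _ _ A) => [||w Aw]; [exact: open_nbhs_nbhs|exact: h_diff|].
by have := zmin w; rewrite -(fineK (h_fin Az)) -(fineK (h_fin Aw)) lee_fin.
Qed.

Lemma legendre_fine : legendre A (fine \o h).
Proof.
split=> // [|y]; first exact: strictly_convex_on_fine.
by have [z Az zmin] := h_argmin y; exists z => //; exact: argmin_grad.
Qed.

Lemma legendre_dual_conjugate :
  legendre_dual A (fine \o h) (fine \o conjugate h).
Proof.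
move=> a Aa; have [z Az zmin] := h_argmin (grad (fine \o h) a).
have <- : z = a.
  by apply: (legendre_grad_inj legendre_fine) => //; exact: argmin_grad.
by rewrite /= (argmin_grad Az zmin) (conjugate_argmin (h_fin Az) zmin).
Qed.

End ExtendedConvex.

Section CoordinatewiseMeasurable.
Context {R : realType} {d : nat}.
Implicit Types (q : 'rV[rat]_d) (B : set 'rV[R]_d).

Lemma rational_row_dense B : open B -> B !=set0 ->
  exists q, B (map_mx ratr q).
Proof.
move=> openB [z Bz].
have /nbhs_ballP[r /= r0 ballB] : nbhs z B by exact: open_nbhs_nbhs.
have /choice[q qz] i : exists q : rat, ball (z 0 i) r (ratr q : R).
  have [|s [zs [q _ qE]]] := @dense_rat R (ball (z 0 i) r) _ (ball_open _ r).
    by exists (z 0 i); exact: ballxx.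
  by exists q; rewrite qE.
exists (\row_i q i); apply: ballB; split => // i j.
by rewrite !mxE ord1; exact: qz.
Qed.

Definition rational_ball (p : 'rV[rat]_d * rat) : set 'rV[R]_d :=
  ball (map_mx ratr p.1 : 'rV[R]_d) (ratr p.2).

Lemma open_bigcup_rational_ball B : open B ->
  B = \bigcup_(p in [set p | rational_ball p `<=` B]) rational_ball p.
Proof.
move=> openB; apply/seteqP; split => [z Bz|z [p pB pz]]; last exact: pB.
have /nbhs_ballP[e /= e0 ballB] : nbhs z B by exact: open_nbhs_nbhs.
have /rat_in_itvoo[r] : 0 < e / 2 by rewrite divr_gt0.
rewrite in_itv/= => /andP[r0 re].
have [|q qz] := rational_row_dense (ball_open z (ratr r)).
  by exists z; exact: ballxx.
exists (q, r) => [w qw|]; last exact: ball_sym.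
apply: ballB; apply: le_ball (ball_triangle qz qw); lra.
Qed.

Definition measurable_coords {dX : measure_display} {X : measurableType dX}
    (u : X -> 'rV[R]_d) : Prop :=
  forall i, measurable_fun [set: X] (fun xi => u xi 0 i).

Lemma measurable_preimage_ball {dX : measure_display} {X : measurableType dX}
    (u : X -> 'rV[R]_d) (a : 'rV[R]_d) (r : R) :
  measurable_coords u -> measurable (u @^-1` ball a r).
Proof.
move=> mu; have [r0|r_le0] := ltP 0 r; last first.
  by rewrite (_ : _ @^-1` _ = set0)// -subset0 => xi []; rewrite ltNge r_le0.
have -> : u @^-1` ball a r =
    \bigcap_(i in [set: 'I_d]) ((fun xi => u xi 0 i) @^-1` ball (a 0 i) r).
  apply/seteqP; split=> [xi [_ /= xi_ball] i _|xi xi_ball]; first exact: xi_ball.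
  by split => // i j; rewrite ord1; exact: xi_ball.
apply: fin_bigcap_measurable => // i _; rewrite -[X in measurable X]setTI.
by apply: mu => //; exact: measurable_ball.
Qed.

Lemma measurable_continuous_comp {dX : measure_display} {X : measurableType dX}
    (u : X -> 'rV[R]_d) (g : 'rV[R]_d -> R) :
  measurable_coords u -> continuous g -> measurable_fun [set: X] (g \o u).
Proof.
move=> mu ctg; apply: (measurability _ (RGenOInfty.measurableE R)).
move=> _ [_ [a ->] <-]; rewrite setTI comp_preimage.
have /open_bigcup_rational_ball -> : open (g @^-1` `]a, +oo[).
  by apply: open_comp => [w _|]; [exact: ctg|exact: interval_open].
rewrite preimage_bigcup bigcup_mkcond.
apply: countable_bigcupT_measurable => [|p]; first exact: countableP.
case: ifPn => // _.
rewrite comp_preimage; exact: measurable_preimage_ball.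
Qed.

End CoordinatewiseMeasurable.

(* The integral of [f] is the difference of two suprema over simple functions
   below [f^+] and [f^-], hence monotone even for non-measurable functions. *)
Lemma le_integral_nonmeasurable {dX : measure_display} {X : measurableType dX}
    {R : realType} (mu : {measure set X -> \bar R}) (f g : X -> \bar R) :
  (forall x, f x <= g x)%E -> (\int[mu]_x f x <= \int[mu]_x g x)%E.
Proof.
move=> fg; have ge0_le (u v : X -> \bar R) : (forall x, 0 <= u x)%E ->
    (forall x, u x <= v x)%E -> (\int[mu]_x u x <= \int[mu]_x v x)%E.
  move=> u0 uv; have v0 x : (0 <= v x)%E by exact: le_trans (uv x).
  rewrite !ge0_integralTE//.
  apply: ereal_sup_le => _ [k /= ku <-]; exists k => // x.
  exact: le_trans (ku x) (uv x).
rewrite integralE [leRHS]integralE leeB//; apply: ge0_le => // x.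
- by apply: (@funepos_le _ _ [set: X]) => [y _|]; rewrite ?inE.
- by apply: (@funeneg_le _ _ [set: X]) => [y _|]; rewrite ?inE.
Qed.

Lemma integrable_between {dX : measure_display} {X : measurableType dX}
    {R : realType} (mu : {measure set X -> \bar R}) (lo g hi : X -> R) :
  measurable_fun [set: X] g ->
  mu.-integrable [set: X] (EFin \o lo) -> mu.-integrable [set: X] (EFin \o hi) ->
  (forall x, lo x <= g x <= hi x) -> mu.-integrable [set: X] (EFin \o g).
Proof.
move=> mg /integrable_norm ilo /integrable_norm ihi lo_g_hi.
apply: (le_integrable _ _ _ (integrableD _ ilo ihi)) => //.
  exact/measurable_EFinP.
move=> x _; rewrite /= lee_fin [leRHS]ger0_norm ?addr_ge0// ler_norml.
have := lo_g_hi x; have := ler_norm (- lo x); have := ler_norm (hi x).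
by have := normr_ge0 (lo x); have := normr_ge0 (hi x); rewrite normrN; lra.
Qed.

Definition has_mean {dX : measure_display} {X : measurableType dX} {R : realType}
    (P : probability X R) (g : X -> R) (m : R) : Prop :=
  P.-integrable [set: X] (EFin \o g) /\ (\int[P]_xi (g xi)%:E = m%:E)%E.

(* The upper integral of [g] is at most [b]; [g] itself may be non-measurable. *)
Definition mean_le {dX : measure_display} {X : measurableType dX} {R : realType}
    (P : probability X R) (g : X -> R) (b : R) : Prop :=
  exists2 G : X -> R, has_mean P G b & forall xi, g xi <= G xi.

Section Means.
Context {dX : measure_display} {X : measurableType dX} {R : realType}.
Variable P : probability X R.
Implicit Types (g k : X -> R) (a b c : R).

Lemma integrable_has_mean g : P.-integrable [set: X] (EFin \o g) ->
  exists m, has_mean P g m.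
Proof.
move=> ig; exists (fine (\int[P]_xi (g xi)%:E)%E); split => //.
by rewrite fineK//; exact: integrable_fin_num.
Qed.

Lemma has_mean_cst a : has_mean P (fun=> a) a.
Proof.
split; first exact: finite_measure_integrable_cst.
by rewrite (integral_cst P)// [X in (_ * X)%E]probability_setT mule1.
Qed.

Lemma has_meanD g k a b : has_mean P g a -> has_mean P k b ->
  has_mean P (fun xi => g xi + k xi) (a + b).
Proof.
move=> [ig ga] [ik kb]; split; first exact: (integrableD measurableT ig ik).
by rewrite integralD_EFin// ga kb.
Qed.

Lemma has_meanZ c g a : has_mean P g a ->
  has_mean P (fun xi => c * g xi) (c * a).
Proof.
move=> [ig ga]; split; first exact: (integrableZl measurableT c ig).
by under eq_integral do rewrite EFinM; rewrite integralZl// ga.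
Qed.

Lemma has_meanN g a : has_mean P g a -> has_mean P (fun xi => - g xi) (- a).
Proof.
by move=> /(has_meanZ (- 1)); rewrite mulN1r; under eq_fun do rewrite mulN1r.
Qed.

Lemma has_meanB g k a b : has_mean P g a -> has_mean P k b ->
  has_mean P (fun xi => g xi - k xi) (a - b).
Proof. by move=> ga /has_meanN; exact: has_meanD. Qed.

Lemma ler_has_mean g k a b : has_mean P g a -> has_mean P k b ->
  (forall xi, g xi <= k xi) -> a <= b.
Proof.
move=> [ig ga] [ik kb] gk; rewrite -lee_fin -ga -kb.
by apply: le_integral => // xi _; rewrite lee_fin.
Qed.

Lemma has_mean_le g a : has_mean P g a -> mean_le P g a.
Proof. by move=> ga; exists g. Qed.

Lemma mean_le_trans g k a b : (forall xi, g xi <= k xi) -> a <= b ->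
  mean_le P k a -> mean_le P g b.
Proof.
move=> gk ab [G Ga kG]; exists (fun xi => G xi + (b - a)) => [|xi].
  by rewrite -[X in has_mean _ _ X](subrKC a); exact: has_meanD (has_mean_cst _).
by rewrite (le_trans (gk xi))// (le_trans (kG xi))// lerDl subr_ge0.
Qed.

Lemma mean_leD g k a b : mean_le P g a -> mean_le P k b ->
  mean_le P (fun xi => g xi + k xi) (a + b).
Proof.
move=> [G Ga gG] [K Kb kK].
by exists (fun xi => G xi + K xi) => [|xi]; [exact: has_meanD|rewrite lerD].
Qed.

Lemma mean_leZ c g a : 0 <= c -> mean_le P g a ->
  mean_le P (fun xi => c * g xi) (c * a).
Proof.
move=> c0 [G Ga gG].
by exists (fun xi => c * G xi) => [|xi]; [exact: has_meanZ|rewrite ler_wpM2l].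
Qed.

Lemma ge0_integral_mean_le g b : measurable_fun [set: X] g ->
  (forall xi, 0 <= g xi) -> (\int[P]_xi (g xi)%:E <= b%:E)%E -> mean_le P g b.
Proof.
move=> mg g0 gb.
have ig : P.-integrable [set: X] (EFin \o g).
  apply/integrableP; split; first exact/measurable_EFinP.
  under eq_integral do rewrite gee0_abs ?lee_fin//.
  exact: le_lt_trans gb (ltry _).
have [m gm] := integrable_has_mean ig.
apply: (mean_le_trans _ _ (has_mean_le gm)) => //.
by move: gb; rewrite gm.2 lee_fin.
Qed.

Lemma mean_le_integral g b : mean_le P g b -> (\int[P]_xi (g xi)%:E <= b%:E)%E.
Proof.
move=> [G [_ <-] gG]; apply: le_integral_nonmeasurable => xi.
by rewrite lee_fin.
Qed.

End Means.

Section IteratedExpectation.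
Context {R : realType} {dX : measure_display} {X : measurableType dX}.
Variable P : probability X R.
Implicit Types (V Phi delta : seq X -> R).

Lemma iexp_le_supermartingale n V (G : seq X -> \bar R) :
  (forall s, mean_le P (fun xi => V (rcons s xi)) (V s)) ->
  (forall s, size s = n -> (G s <= (V s)%:E)%E) ->
  (iexp P n G <= (V [::])%:E)%E.
Proof.
elim: n V G => [|n IH] V G V_mean GV /=; first exact: GV.
apply: le_trans (mean_le_integral (V_mean [::])).
apply: le_integral_nonmeasurable => xi.
apply: (IH (fun s => V (xi :: s))) => [s|s sn]; first exact: (V_mean (xi :: s)).
by apply: GV; rewrite /= sn.
Qed.

(* [Phi] also pays for the term [t = n], beyond the [n] steps of the chain. *)
Lemma iexp_sum_le_potential n Phi delta (c : R) :
  (forall s, delta s <= Phi s) ->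
  (forall s, mean_le P (fun xi => Phi (rcons s xi)) (Phi s - delta s + c)) ->
  (iexp P n (fun s => (\sum_(0 <= t < n.+1) delta (take t s))%:E)
   <= (Phi [::] + n%:R * c)%:E)%E.
Proof.
move=> delta_le step.
pose V s := \sum_(0 <= t < size s) delta (take t s) + Phi s
  + (n%:R - (size s)%:R) * c.
have -> : Phi [::] + n%:R * c = V [::] by rewrite /V /= big_geq// add0r subr0.
apply: iexp_le_supermartingale => [s|s sn]; last first.
  rewrite lee_fin /V sn subrr mul0r addr0 big_nat_recr//= lerD2l.
  by rewrite -sn take_size.
pose b := \sum_(0 <= t < size s) delta (take t s) + delta s
  + (n%:R - (size s).+1%:R) * c.
have VE xi : V (rcons s xi) = b + Phi (rcons s xi).
  rewrite /V /b size_rcons big_nat_recr//= -cats1 take_size_cat//.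
  rewrite (eq_big_nat _ _ (F2 := fun t => delta (take t s))); first ring.
  by move=> t /andP[_ ts]; rewrite takel_cat// ltnW.
under eq_fun do rewrite VE.
have -> : V s = b + (Phi s - delta s + c) by rewrite /V /b -natr1; ring.
exact: mean_leD (has_mean_le (has_mean_cst P b)) (step s).
Qed.

End IteratedExpectation.
Section StochasticGradient.
Context {R : realType} {d : nat} {dX : measure_display} {X : measurableType dX}.
Context {P : probability X R} {A : set 'rV[R]_d}.
Context {F : X -> 'rV[R]_d -> R} {f : 'rV[R]_d -> R}.
Hypothesis openA : open A.
Hypothesis F_mean : forall w, A w -> has_mean P (F ^~ w) (f w).
Hypothesis F_convex : forall xi, convex_on A (F xi).
Hypothesis F_diff : forall xi w, A w -> differentiable (F xi) w.
Hypothesis F_meas : forall w, A w -> measurable_coords (fun xi => grad (F xi) w).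
Hypothesis f_diff : forall w, A w -> differentiable f w.
Implicit Types (v y z : 'rV[R]_d).

Let near_ray z v : A z -> \forall t \near (0 : R)^'+, A (z + t *: v).
Proof. by move=> Az; apply: near_right_ray; exact: open_nbhs_nbhs. Qed.

Lemma has_mean_difference_quotient z v (t : R) : A z -> A (z + t *: v) ->
  has_mean P (fun xi => t^-1 * (F xi (z + t *: v) - F xi z))
    (t^-1 * (f (z + t *: v) - f z)).
Proof. by move=> Az At; apply/has_meanZ/has_meanB; exact: F_mean. Qed.

(* By convexity the slope along [v] lies between the difference quotients along
   [- v] and [v], both of which have means. *)
Lemma integrable_dotp_grad z v : A z ->
  P.-integrable [set: X] (EFin \o (fun xi => dotp (grad (F xi) z) v)).
Proof.
move=> Az.
have /filter_ex[t [t0 Av ANv]] :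
    \forall t \near (0 : R)^'+, [/\ 0 < t, A (z + t *: v) & A (z + t *: - v)].
  near=> t; split; near: t; [exact: nbhs_right_gt|exact: near_ray..].
have [iv _] := has_mean_difference_quotient Az Av.
have [iNv _] := has_meanN (has_mean_difference_quotient Az ANv).
apply: (integrable_between _ iNv iv) => [|xi].
  under eq_fun do rewrite dotpC.
  exact: (measurable_continuous_comp (F_meas Az) (@dotp_continuous _ _ v)).
have := dotp_grad_le_difference_quotient (F_convex xi) Az ANv (F_diff xi Az) t0.
rewrite dotpNr lerNl => ->.
exact: dotp_grad_le_difference_quotient (F_convex xi) Az Av (F_diff xi Az) t0.
Unshelve. all: by end_near. Qed.

(* The mean slope is at most every difference quotient of [f]; applied to [v] and
   [- v], this replaces differentiation under the integral sign. *)
Lemma has_mean_dotp_grad z v : A z ->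
  has_mean P (fun xi => dotp (grad (F xi) z) v) (dotp (grad f z) v).
Proof.
move=> Az.
have mean_slope_le u m : has_mean P (fun xi => dotp (grad (F xi) z) u) m ->
    m <= dotp (grad f z) u.
  move=> mE; apply: cvgr_to_ge (cvg_difference_quotient (f_diff Az)) _.
  near=> t; have t0 : 0 < t by near: t; exact: nbhs_right_gt.
  have At : A (z + t *: u) by near: t; exact: near_ray.
  apply: (ler_has_mean mE (has_mean_difference_quotient Az At)) => xi.
  exact: dotp_grad_le_difference_quotient (F_convex xi) Az At (F_diff xi Az) t0.
have [m mE] := integrable_has_mean (integrable_dotp_grad v Az).
suff <- : m = dotp (grad f z) v by [].
apply/eqP; rewrite eq_le mean_slope_le//= -lerN2 -dotpNr; apply: mean_slope_le.
by under eq_fun do rewrite dotpNr; exact: has_meanN.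
Unshelve. all: by end_near. Qed.

Lemma has_mean_bregman y z : A y -> A z ->
  has_mean P (fun xi => bregman (F xi) y z) (bregman f y z).
Proof.
move=> Ay Az; apply: has_meanB (has_mean_dotp_grad (y - z) Az).
exact: has_meanB (F_mean Ay) (F_mean Az).
Qed.

Context {phi psi : 'rV[R]_d -> R}.
Hypotheses (phi_legendre : legendre A phi) (psi_dual : legendre_dual A phi psi).

Lemma mean_mirror_step_descent (L eta b : R) x xs (xn : X -> 'rV[R]_d) :
  (forall xi, rel_smooth A L (F xi) phi) -> 0 <= eta -> 2 * eta * L <= 1 ->
  A x -> A xs -> grad f xs = 0 -> (forall xi, A (xn xi)) ->
  (forall xi, grad phi (xn xi) = grad phi x - eta *: grad (F xi) x) ->
  (\int[P]_xi (bregman psi (grad phi x - (2 * eta) *: grad (F xi) xs)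
     (grad phi x))%:E <= b%:E)%E ->
  mean_le P (fun xi => bregman phi xs (xn xi))
    (bregman phi xs x - eta * bregman f xs x + 2^-1 * b).
Proof.
move=> F_smooth eta0 etaL Ax Axs gradf0 Axn xnE noise.
pose noise_at v := bregman psi (grad phi x - (2 * eta) *: v) (grad phi x).
have noise_continuous : continuous noise_at.
  move=> v; have stepv : (grad phi x - (2 * eta) *: w @[w --> v] -->
      grad phi x - (2 * eta) *: v)%classic.
    exact: (cvgB (cvg_cst (grad phi x)) (cvgZl_tmp (k := 2 * eta) cvg_id)).
  have dpsi := differentiable_legendre_dual phi_legendre psi_dual
    (grad phi x - (2 * eta) *: v).
  exact: (continuous_cvg _ (bregman_continuous dpsi) stepv).
have noise_mean : mean_le P (fun xi => noise_at (grad (F xi) xs)) b.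
  apply: ge0_integral_mean_le noise => [|xi].
    exact: (measurable_continuous_comp (F_meas Axs) noise_continuous).
  exact: (bregman_legendre_dual_ge0 phi_legendre psi_dual).
apply: mean_le_trans (fun xi => mirror_step_descent phi_legendre psi_dual
  (F_convex xi) (F_diff xi Axs) (F_smooth xi) eta0 etaL Ax Axs (Axn xi) (xnE xi))
  (lexx _) _.
apply: mean_leD (mean_leZ _ noise_mean); last by rewrite invr_ge0.
rewrite -[X in mean_le _ _ X]subr0 -(mulr0 eta) -(dotp0l (x - xs)) -gradf0.
apply/has_mean_le/has_meanB; last exact/has_meanZ/has_mean_dotp_grad.
apply: has_meanB; first exact: has_mean_cst.
exact/has_meanZ/has_mean_bregman.
Qed.

Lemma iexp_mirror_descent_le (L eta sigma2 : R) xs (x : seq X -> 'rV[R]_d) n :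
  rel_smooth A L f phi -> (forall xi, rel_smooth A L (F xi) phi) ->
  0 < eta -> 2 * eta * L <= 1 -> A xs -> grad f xs = 0 -> (forall s, A (x s)) ->
  (forall s xi, grad phi (x (rcons s xi)) =
     grad phi (x s) - eta *: grad (F xi) (x s)) ->
  (forall s, \int[P]_xi
       (bregman psi (grad phi (x s) - (2 * eta) *: grad (F xi) xs)
          (grad phi (x s)))%:E
     <= (2 * eta ^+ 2 * sigma2)%:E)%E ->
  (0 < n)%N ->
  (iexp P n (fun s => (n%:R^-1 *
      \sum_(0 <= t < n.+1) bregman f xs (x (take t s)))%:E)
   <= (bregman phi xs (x [::]) / (eta * n%:R) + eta * sigma2)%:E)%E.
Proof.
move=> f_smooth F_smooth eta0 etaL Axs gradf0 Ax xE noise n0.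
have n_gt0 : 0 < n%:R :> R by rewrite ltr0n.
have eta_n0 : 0 < eta * n%:R by exact: mulr_gt0.
pose delta s := n%:R^-1 * bregman f xs (x s).
pose Phi s := (eta * n%:R)^-1 * bregman phi xs (x s).
have delta_le s : delta s <= Phi s.
  have := f_smooth xs (x s) Axs (Ax s).
  have := legendre_bregman_ge0 phi_legendre Axs (Ax s).
  rewrite /Phi invfM -mulrA mulrCA ler_pM2l ?invr_gt0// ler_pdivlMl//; nra.
have step s : mean_le P (fun xi => Phi (rcons s xi))
    (Phi s - delta s + n%:R^-1 * (eta * sigma2)).
  have -> : Phi s - delta s + n%:R^-1 * (eta * sigma2) =
      (eta * n%:R)^-1 * (bregman phi xs (x s) - eta * bregman f xs (x s)
        + 2^-1 * (2 * eta ^+ 2 * sigma2)).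
    by rewrite /Phi /delta; field; rewrite !gt_eqF.
  apply: mean_leZ; first by rewrite invr_ge0 ltW.
  exact: (mean_mirror_step_descent F_smooth (ltW eta0) etaL (Ax s) Axs gradf0
    (fun xi => Ax (rcons s xi)) (xE s) (noise s)).
under [X in iexp _ _ X]eq_fun do rewrite mulr_sumr.
apply: le_trans (iexp_sum_le_potential n delta_le step) _.
by rewrite lee_fin mulVKf ?gt_eqF// /Phi mulrC.
Qed.

End StochasticGradient.

Theorem theorem3
  (R : realType) (d : nat)
  (C : set 'rV[R]_d) (h : 'rV[R]_d -> \bar R)
  (dX : measure_display) (Xi : measurableType dX) (P : probability Xi R)
  (F : Xi -> 'rV[R]_d -> R) (f : 'rV[R]_d -> R)
  (L eta sigma2 : R) (xstar x0 : 'rV[R]_d) (x : seq Xi -> 'rV[R]_d) :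
  let hR := fun z => fine (h z) in
  let hstar := fun y => fine (conjugate h y) in
  (* standing assumption on C and h *)
  closed C -> convex_set C ->
  (forall z, h z != -oo%E) ->
  (forall z, ~ C z -> h z = +oo%E) ->
  (forall z, interior C z -> h z \is a fin_num) ->
  C2_on (interior C) hR ->
  strictly_convex_on (interior C) h ->
  (forall y : 'rV[R]_d, exists z, [/\ C z,
      (forall w, C w -> (h z - (dotp z y)%:E <= h w - (dotp w y)%:E)%E),
      (forall w, C w ->
         (forall w', C w' -> (h w - (dotp w y)%:E <= h w' - (dotp w' y)%:E)%E) ->
         w = z) &
      interior C z]) ->
  (* the stochastic objective: f = E_xi[f_xi] *)
  (forall z, interior C z -> P.-integrable [set: Xi] (fun xi => (F xi z)%:E)) ->
  (forall z, interior C z -> (f z)%:E = (\int[P]_xi (F xi z)%:E)%E) ->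
  (forall z, interior C z -> differentiable f z) ->
  0 < L -> rel_smooth (interior C) L f hR ->
  (* minimizer x* *)
  interior C xstar -> (forall z, interior C z -> f xstar <= f z) ->
  grad f xstar = 0 ->
  (* noise assumption *)
  (forall xi, convex_on (interior C) (F xi)) ->
  (forall xi z, interior C z -> differentiable (F xi) z) ->
  (forall xi, rel_smooth (interior C) L (F xi) hR) ->
  (forall z (i : 'I_d), interior C z ->
     measurable_fun [set: Xi] (fun xi => grad (F xi) z 0 i)) ->
  0 <= sigma2 ->
  (forall s : seq Xi,
     ((2 * eta ^+ 2)^-1%:E *
       \int[P]_xi (bregman hstar (grad hR (x s) - (2 * eta) *: grad (F xi) xstar)
                                 (grad hR (x s)))%:E <= sigma2%:E)%E) ->
  (* step size *)
  0 < eta -> eta <= (2 * L)^-1 ->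
  (* BSGD iterates: x [:: xi_0; ...; xi_(t-1)] = x_t *)
  interior C x0 -> x [::] = x0 ->
  (forall s xi, interior C (x (rcons s xi)) /\
     grad hR (x (rcons s xi)) = grad hR (x s) - eta *: grad (F xi) (x s)) ->
  (forall (t : nat) (i : 'I_d),
     measurable_fun [set: t.-tuple Xi] (fun s : t.-tuple Xi => x (tval s) 0 i)) ->
  forall T : nat, (1 <= T)%N ->
  (iexp P T (fun s => ((T%:R)^-1 *
      \sum_(0 <= t < T.+1) bregman f xstar (x (take t s)))%:E)
   <= (bregman hR xstar x0 / (eta * T%:R) + eta * sigma2)%:E)%E.
Proof.
move=> hR hstar _ _ hNy h_out h_fin [h_diff _ _] h_strict h_min F_int fE
  f_diff L0 f_smooth ixs _ gradf0 F_convex F_diff F_smooth F_meas _ noise eta0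
  etaL ix0 x_nil x_step _ T T0.
have h_argmin y : exists2 z, interior C z &
    forall w, (h z - (dotp z y)%:E <= h w - (dotp w y)%:E)%E.
  have [z [_ zmin _ iz]] := h_min y; exists z => // w.
  by have [/zmin //|/h_out ->] := pselect (C w); rewrite leey.
have openI := @open_interior _ C.
have h_legendre : legendre (interior C) hR by exact: legendre_fine.
have h_dual : legendre_dual (interior C) hR hstar.
  exact: legendre_dual_conjugate.
have F_mean z : interior C z -> has_mean P (F ^~ z) (f z).
  by move=> iz; split; [exact: F_int|rewrite fE].
have ix s : interior C (x s).
  by case/lastP: s => [|s xi]; [rewrite x_nil|have [] := x_step s xi].
have eta2L : 2 * eta * L <= 1.
  by move: etaL; rewrite -[leRHS]mul1r ler_pdivlMr ?mulr_gt0//; lra.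
rewrite -x_nil; apply: (iexp_mirror_descent_le openI F_mean F_convex F_diff _
  f_diff h_legendre h_dual f_smooth F_smooth eta0 eta2L ixs gradf0 ix)
  => // [z iz i|s xi|s].
- exact: F_meas.
- by have [] := x_step s xi.
- by rewrite EFinM -lee_pdivrMl ?mulr_gt0 ?exprn_gt0.
Qed.
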